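(* Let $R_q(k,s,m)$ be the number of solutions $(Y_1,Z_1,U_1,\ldots,Y_q,Z_q,U_q)$ in $\mathbb{F}_2[T]$ of \[\begin{cases} Y_1Z_1+Y_2Z_2+\cdots+Y_qZ_q=0,\\ Y_1U_1+Y_2U_2+\cdots+Y_qU_q=0,\end{cases}\] with $\deg Y_i\leq k-1$, $\deg Z_i\leq s-1$, $\deg U_i\leq s+m-1$ for $1\leq i\leq q$. Then $$R_q(k,s,m) = \int_{\mathbb{P}\times\mathbb{P}} g_{k,s,m}^{q}(t,\eta)\,dt\,d\eta = 2^{(2s+m+k)(q-1)}\cdot 2^{-k+2}\cdot\sum_{i=0}^{\inf(2s+m,k)}\Gamma_{i}^{\left[\substack{s\\ s+m}\right]\times k}\cdot 2^{-qi}.$$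
   Context: $\mathbb{K}=\mathbb{F}_2((T^{-1}))$, $\mathbb{P}$ its unit interval with normalized Haar measure, $E$ the additive character of $\mathbb{K}$ ($E(\sum a_iT^i)=(-1)^{a_{-1}}$), and $g_{k,s,m}(t,\eta)=\sum_{\deg Y\leq k-1}\sum_{\deg Z\leq s-1}E(tYZ)\sum_{\deg U\leq s+m-1}E(\eta YU)$. $\Gamma_{i}^{\left[\substack{s\\ s+m}\right]\times k}$ is the number of rank $i$ matrices $\left[\frac{A}{B}\right]$ over $\mathbb{F}_2$ with $A$ an $s\times k$ and $B$ an $(s+m)\times k$ persymmetric matrix. *)

(* Defs.v *)
From HB Require Import structures.
From mathcomp Require Import all_boot all_order all_algebra.
From mathcomp Require Import zify lra.
From mathcomp Require Import all_classical all_reals all_analysis.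

Set Implicit Arguments.
Unset Strict Implicit.
Unset Printing Implicit Defensive.
Import Order.TTheory GRing.Theory Num.Theory.
Import numFieldNormedType.Exports.
Local Open Scope classical_set_scope.
Local Open Scope ring_scope.

(* F_2((T^-1)): an element is its family of coefficients (a_i), a_i being the
   coefficient of T^i, with a_i = 0 for all large i. *)
Definition upper_bounded (a : int -> 'F_2) : bool :=
  `[< exists d : int, forall i, d < i -> a i = 0 >].

Record laurent := Laurent {
  lcoef :> int -> 'F_2;
  _ : upper_bounded lcoef
}.

HB.instance Definition _ := [isSub for lcoef].
HB.instance Definition _ := [Choice of laurent by <:].

Lemma upper_bounded_zmod_closed : zmod_closed upper_bounded.
Proof.
split=> [|a b /asboolP[d ad] /asboolP[e be]]; first by apply/asboolP; exists 0.
apply/asboolP; exists (Num.max d e) => i; rewrite gt_max => /andP[di ei].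
by rewrite !fctE /= ad// be// subr0.
Qed.

HB.instance Definition _ :=
  GRing.isZmodClosed.Build (int -> 'F_2) upper_bounded upper_bounded_zmod_closed.
HB.instance Definition _ := [SubChoice_isSubZmodule of laurent by <:].

(* The sum is finite when both families are bounded above; \sum_(_ \in _) would
   be 0 on an infinite support. *)
Definition lconv (a b : int -> 'F_2) : int -> 'F_2 :=
  fun n => \sum_(i \in [set: int]) a i * b (n - i).

Definition ltrunc (d : int) (N : nat) (a : int -> 'F_2) : {poly 'F_2} :=
  \poly_(l < N) a (d - l%:Z).

Lemma lconvE (a b : int -> 'F_2) (d e : int) (N r : nat) :
  (forall i, d < i -> a i = 0) -> (forall i, e < i -> b i = 0) -> (r < N)%N ->
  lconv a b (d + e - r%:Z) = (ltrunc d N a * ltrunc e N b)`_r.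
Proof.
move=> ad be rN; rewrite coefM /lconv.
pose F (i : int) := a i * b (d + e - r%:Z - i).
pose h (j : nat) : int := d - j%:Z.
transitivity (\sum_(j < r.+1) F (h j)); last first.
  apply: eq_bigr => j _; rewrite !coef_poly /F /h.
  have jr : (j <= r)%N by rewrite -ltnS.
  rewrite (leq_ltn_trans jr rN) (leq_ltn_trans (leq_subr _ _) rN).
  by congr (_ * b _); lia.
rewrite (fsbig_ord _ _ (fun j => F (h j))) -(@fsbig_image _ _ _ _ _ _ h F).
  symmetry; apply: fsbig_widen => // i [_ hi]; change (F i = 0); rewrite /F.
  have [di|id] := ltP d i; first by rewrite ad ?mul0r.
  rewrite be ?mulr0//; rewrite ltNge; apply/negP => ei; apply: hi.
  by exists (absz (d - i)%R) => /=; rewrite /h; lia.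
by move=> i j _ _; rewrite /h; lia.
Qed.

Lemma lconv_bound (a b : int -> 'F_2) (d e : int) :
  (forall i, d < i -> a i = 0) -> (forall i, e < i -> b i = 0) ->
  forall n, d + e < n -> lconv a b n = 0.
Proof.
move=> ad be n den; apply: fsbig1 => i _.
have [di|id] := ltP d i; first by rewrite ad ?mul0r.
by rewrite be ?mulr0//; lia.
Qed.

Lemma upper_bounded_lconv (a b : laurent) : upper_bounded (lconv a b).
Proof.
case: a b => a /= /asboolP[d ad] [b /= /asboolP[e be]].
by apply/asboolP; exists (d + e); exact: lconv_bound.
Qed.

Definition laurent_mul (a b : laurent) := Laurent (upper_bounded_lconv a b).

Definition poly_coefz (p : {poly 'F_2}) (i : int) : 'F_2 :=
  if i is Posz n then p`_n else 0.

Lemma upper_bounded_poly p : upper_bounded (poly_coefz p).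
Proof.
apply/asboolP; exists (size p)%:Z => -[n|n] //= np.
by rewrite nth_default//; lia.
Qed.

Definition laurent_of_poly (p : {poly 'F_2}) := Laurent (upper_bounded_poly p).

Lemma laurentP (a b : laurent) : a =1 b -> a = b.
Proof. by move=> ab; apply/val_inj/funext. Qed.

Lemma laurent_boundP (a : laurent) :
  exists d : int, forall i, d < i -> a i = 0.
Proof. by case: a => a /= /asboolP. Qed.

Lemma coefM_congr (p p' q q' : {poly 'F_2}) (N r : nat) : (r < N)%N ->
  (forall j, (j < N)%N -> p`_j = p'`_j) -> (forall j, (j < N)%N -> q`_j = q'`_j) ->
  (p * q)`_r = (p' * q')`_r.
Proof.
move=> rN pp' qq'; rewrite !coefM; apply: eq_bigr => j _.
have jr : (j <= r)%N by rewrite -ltnS.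
by rewrite pp' ?qq' ?(leq_ltn_trans _ rN)// leq_subr.
Qed.

Lemma coef_ltrunc_lconv (a b : int -> 'F_2) (d e : int) (N r : nat) :
  (forall i, d < i -> a i = 0) -> (forall i, e < i -> b i = 0) -> (r < N)%N ->
  (ltrunc (d + e) N (lconv a b))`_r = (ltrunc d N a * ltrunc e N b)`_r.
Proof. by move=> ad be rN; rewrite coef_poly rN (lconvE ad be rN). Qed.

Lemma laurent_mulC : commutative laurent_mul.
Proof.
move=> a b; have [[d ad] [e be]] := (laurent_boundP a, laurent_boundP b).
apply: laurentP => n /=.
have [den|nde] := ltP (d + e) n.
  by rewrite (lconv_bound ad be)// (lconv_bound be ad)// addrC.
have -> : n = d + e - (absz (d + e - n)%R)%:Z by lia.
rewrite (lconvE ad be (ltnSn _)) [d + e in RHS]addrC (lconvE be ad (ltnSn _)).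
by rewrite addrC mulrC.
Qed.

Lemma laurent_mulA : associative laurent_mul.
Proof.
move=> a b c; have [d ad] := laurent_boundP a.
have [[e be] [f cf]] := (laurent_boundP b, laurent_boundP c).
apply: laurentP => n /=.
have bcef := lconv_bound be cf; have abde := lconv_bound ad be.
have [den|nde] := ltP (d + e + f) n.
  by rewrite (lconv_bound ad bcef) ?addrA// (lconv_bound abde cf).
have -> : n = d + (e + f) - (absz (d + e + f - n)%R)%:Z by lia.
rewrite (lconvE ad bcef (ltnSn _)) addrA (lconvE abde cf (ltnSn _)).
set r := absz _.
transitivity ((ltrunc d r.+1 a * (ltrunc e r.+1 b * ltrunc f r.+1 c))`_r).
  by apply: (coefM_congr (ltnSn _)) => // j jr; rewrite coef_ltrunc_lconv.
rewrite mulrA; apply: (coefM_congr (ltnSn _)) => // j jr.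
by rewrite coef_ltrunc_lconv.
Qed.

Lemma laurent_mulDl : left_distributive laurent_mul +%R.
Proof.
move=> a b c; have [d ad] := laurent_boundP a.
have [[e be] [f cf]] := (laurent_boundP b, laurent_boundP c).
pose g := Num.max d e.
have ag i : g < i -> a i = 0 by rewrite gt_max => /andP[/ad].
have bg i : g < i -> b i = 0 by rewrite gt_max => /andP[_ /be].
have abg i : g < i -> (a + b) i = 0.
  by move=> gi; rewrite /= !fctE ag// bg// addr0.
apply: laurentP => n /=; rewrite !fctE /=.
have [den|nde] := ltP (g + f) n.
  by rewrite (lconv_bound abg cf)// (lconv_bound ag cf)// (lconv_bound bg cf)// addr0.
have -> : n = g + f - (absz (g + f - n)%R)%:Z by lia.
rewrite !(lconvE _ cf (ltnSn _))// -coefD -mulrDl.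
apply: (coefM_congr (ltnSn _)) => // j jN.
by rewrite coefD !coef_poly jN.
Qed.

Lemma laurent_mul1 : left_id (laurent_of_poly 1) laurent_mul.
Proof.
move=> a; have [d ad] := laurent_boundP a; apply: laurentP => n /=.
have b1 i : (0 : int) < i -> poly_coefz 1 i = 0.
  by case: i => // -[|i] //=; rewrite coef1.
have [dn|nd] := ltP (0 + d) n.
  by rewrite (lconv_bound b1 ad)// ad//; lia.
have -> : n = 0 + d - (absz (0 + d - n)%R)%:Z by lia.
rewrite (lconvE b1 ad (ltnSn _)).
set r := absz _.
transitivity ((1 * ltrunc d r.+1 a)`_r); last first.
  by rewrite mul1r coef_poly ltnSn add0r.
apply: (coefM_congr (ltnSn _)) => // -[|j] jr;
  by rewrite coef_poly jr /= coef1.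
Qed.

Lemma laurent_one_neq0 : laurent_of_poly 1 != 0.
Proof. by apply/eqP => /(congr1 (fun a : laurent => a 0)); rewrite /= coef1. Qed.

HB.instance Definition _ := GRing.Zmodule_isComNzRing.Build laurent
  laurent_mulA laurent_mulC laurent_mul1 laurent_mulDl laurent_one_neq0.

Section laurent_topology.

(* The ball |y - x| < 2^n, i.e. deg (y - x) < n. *)
Definition laurent_ball (x : laurent) (n : int) : set laurent :=
  [set y | forall i, n <= i -> y i = x i].

Definition laurent_open : set_system laurent :=
  [set U | forall x, U x -> exists n, laurent_ball x n `<=` U].

Lemma laurent_openT : laurent_open setT.
Proof. by move=> x _; exists 0. Qed.

Lemma laurent_openI : setI_closed laurent_open.
Proof.
move=> U V oU oV x [/oU[m mU] /oV[n nV]]; exists (Num.min m n) => y xy; split.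
  by apply: mU => i mi; apply: xy; rewrite ge_min mi.
by apply: nV => i ni; apply: xy; rewrite ge_min ni orbT.
Qed.

Lemma laurent_open_bigU (I : Type) (F : I -> set laurent) :
  (forall i, laurent_open (F i)) -> laurent_open (\bigcup_i F i).
Proof.
move=> oF x [i _ /oF[n nF]]; exists n => y /nF Fy; by exists i.
Qed.

HB.instance Definition _ := isOpenTopological.Build laurent
  laurent_openT laurent_openI laurent_open_bigU.

End laurent_topology.

(* The valuation ideal |t| < 1. *)
Definition in_unit_interval (t : laurent) : bool :=
  `[< forall i : int, 0 <= i -> t i = 0 >].

Lemma in_unit_interval_zmod_closed : zmod_closed in_unit_interval.
Proof.
split=> [|a b /asboolP a0 /asboolP b0]; apply/asboolP => i i0 //=.
by rewrite !fctE /= a0// b0// subr0.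
Qed.

HB.instance Definition _ := GRing.isZmodClosed.Build laurent in_unit_interval
  in_unit_interval_zmod_closed.

Record unit_interval := UnitInterval {
  unit_val :> laurent;
  _ : in_unit_interval unit_val
}.

HB.instance Definition _ := [isSub for unit_val].
HB.instance Definition _ := [Choice of unit_interval by <:].
HB.instance Definition _ := [SubChoice_isSubZmodule of unit_interval by <:].
HB.instance Definition _ := isPointed.Build unit_interval 0.
HB.instance Definition _ := Topological.copy unit_interval
  (initial_topology unit_val).
(* Borel sigma-algebra of the subspace topology. *)
HB.instance Definition _ := Measurable.copy unit_interval
  (g_sigma_algebraType (@open unit_interval)).

(* Normalization is part of [probability]: the unit interval has mass 1. *)
Definition is_haar (R : realType) (mu : probability unit_interval R) :=
  forall (x : unit_interval) (A : set unit_interval),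
    measurable A -> mu [set x + y | y in A] = mu A.

Section exponential_sum.
Variable R : realType.

Definition lchar (t : laurent) : R := (-1) ^+ (t (- 1%:Z)).

(* [{poly_n F}] is the finite type of polynomials of degree at most n - 1,
   the zero polynomial included. *)
Definition g_sum (k s m : nat) (t eta : laurent) : R :=
  \sum_(Y : {poly_k 'F_2}) \sum_(Z : {poly_s 'F_2})
    lchar (t * laurent_of_poly Y * laurent_of_poly Z) *
    \sum_(U : {poly_(s + m) 'F_2})
      lchar (eta * laurent_of_poly Y * laurent_of_poly U).

End exponential_sum.

Definition persymmetric (m n : nat) (A : 'M['F_2]_(m, n)) : bool :=
  [forall i1 : 'I_m, forall j1 : 'I_n, forall i2 : 'I_m, forall j2 : 'I_n,
    ((i1 + j1)%N == (i2 + j2)%N) ==> (A i1 j1 == A i2 j2)].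

(* The s x k block A is [usubmx M], the (s + m) x k block B is [dsubmx M]. *)
Definition num_rank (s m k i : nat) : nat :=
  #|[set M : 'M['F_2]_(s + (s + m), k) |
      [&& persymmetric (usubmx M), persymmetric (dsubmx M) & \rank M == i]]%SET|.

Definition num_sol (q k s m : nat) : nat :=
  #|[set w : {ffun 'I_q -> {poly_k 'F_2} * {poly_s 'F_2} * {poly_(s + m) 'F_2}} |
      (\sum_(j < q) polyn (w j).1.1 * polyn (w j).1.2 == 0) &&
      (\sum_(j < q) polyn (w j).1.1 * polyn (w j).2 == 0)]%SET|.

(* A normalized Haar measure exists: image of the Lebesgue measure on [0, 1[
   under the binary expansion. *)
Section haar_existence.
Variable R : realType.

Definition cyl (w : seq 'F_2) : set unit_interval :=
  [set y | forall j, (j < size w)%N -> y (Negz j) = w`_j].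

Lemma unit_interval_nat (x : unit_interval) (n : nat) : x n%:Z = 0.
Proof. by case: x => x /= H; move/asboolP : (H); apply. Qed.

Lemma unit_intervalP (x y : unit_interval) :
  (forall j, x (Negz j) = y (Negz j)) -> x = y.
Proof.
move=> xy; apply: val_inj; apply: laurentP => -[j|j]; last exact: xy.
by rewrite /= !unit_interval_nat.
Qed.

Lemma open_cyl w : open (cyl w).
Proof.
exists [set y : laurent | forall j, (j < size w)%N -> y (Negz j) = w`_j] => //.
move=> x wx; exists (Negz (size w)) => y xy j jw /=.
by rewrite xy ?wx//; lia.
Qed.

Lemma open_cylE (U : set unit_interval) :
  open U -> U = \bigcup_w (if `[< cyl w `<=` U >] then cyl w else set0).
Proof.
move=> [V oV <-]; apply/seteqP; split => [x Vx|x [w _]]; last first.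
  by case: ifPn => // /asboolP; apply.
have [n nV] := oV _ Vx.
pose w := mkseq (fun j => (x : laurent) (Negz j)) `|n|%N.
exists w => //; rewrite ifT.
  by move=> j; rewrite size_mkseq => jn; rewrite nth_mkseq.
apply/asboolP => y wy; apply: nV => i ni.
case: i ni => j nj; first by rewrite !unit_interval_nat.
have jn : (j < `|n|)%N by lia.
by rewrite wy ?size_mkseq// nth_mkseq.
Qed.

Definition cyls : set (set unit_interval) :=
  [set A | A = set0 \/ exists w, A = cyl w].

Lemma measurable_cyls : @measurable _ unit_interval = <<s cyls >>.
Proof.
apply/seteqP; split; apply: smallest_sub; try exact: smallest_sigma_algebra.
  move=> U /open_cylE ->.
  apply: (@countable_bigcupT_measurable _ (g_sigma_algebraType cyls)) => // w.
  case: ifPn => // _; apply: sub_sigma_algebra; right; by exists w.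
move=> A [->|[w ->]]; first exact: (@measurable0 _ unit_interval).
by apply: sub_sigma_algebra; exact: open_cyl.
Qed.

Lemma cyls_setI : setI_closed cyls.
Proof.
suff H (w v : seq 'F_2) : (size w <= size v)%N -> cyls (cyl w `&` cyl v).
  move=> A B [->|[w ->]]; first by rewrite set0I; left.
  move=> [->|[v ->]]; first by rewrite setI0; left.
  have [/H //|/ltnW/H] := leqP (size w) (size v); by rewrite setIC.
move=> wv; have [[x [wx vx]]|no] := pselect (cyl w `&` cyl v !=set0); last first.
  by left; rewrite -(set0P (_ `&` _)) in no; apply/eqP; move/negP: no; rewrite negbK.
right; exists v; apply/seteqP; split => [y []//|y vy]; split => // j jw.
have jv := leq_trans jw wv.
by rewrite vy// -(vx _ jv) wx.
Qed.

Definition digits (x : R) (i : int) : 'F_2 :=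
  if i is Negz n then (Num.floor (x * 2 ^+ n.+1))%:~R else 0.

Lemma digits_bounded x : upper_bounded (digits x).
Proof. by apply/asboolP; exists 0; case. Qed.

Lemma digits_unit x : in_unit_interval (Laurent (digits_bounded x)).
Proof. by apply/asboolP; case. Qed.

Definition dyadic (x : R) : unit_interval := UnitInterval (digits_unit x).

Definition wnum (w : seq 'F_2) : int := foldl (fun (k : int) (b : 'F_2) => 2 * k + (b : nat)%:Z) 0 w.

Lemma F2_le1 (b : 'F_2) : (b <= 1)%N.
Proof. exact: (ltn_ord b). Qed.

Lemma wnum_ge0 w : 0 <= wnum w.
Proof.
elim/last_ind: w => // w b IH; rewrite /wnum foldl_rcons -/(wnum w); lia.
Qed.

Lemma wnum_lt w : wnum w + 1 <= (2 ^ size w)%N%:Z.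
Proof.
elim/last_ind: w => // w b IH.
rewrite /wnum foldl_rcons -/(wnum w) size_rcons expnS.
have := F2_le1 b; lia.
Qed.

Lemma floor_double (y : R) (k : int) (b : 'F_2) :
  (Num.floor y = k /\ (Num.floor (y * 2))%:~R = b) <->
  Num.floor (y * 2) = 2 * k + (b : nat)%:Z.
Proof.
have p2 (l : int) : (2 * l)%:~R = 0 :> 'F_2.
  by rewrite intrM (_ : 2%:~R = 0 :> 'F_2) ?mul0r//; apply/val_inj.
have bE : (b : nat)%:Z%:~R = b by rewrite -pmulrn natr_Zp.
split=> [[yk yb]|yk].
  have /andP[ky yk1] : k%:~R <= y < (k + 1)%:~R by rewrite -floor_eq yk.
  have [y2|y2] := ltP (y * 2) (2 * k + 1)%:~R.
    have E : Num.floor (y * 2) = 2 * k.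
      apply/eqP; rewrite floor_eq y2 andbT; move: ky; rewrite intrM; lra.
    by move: yb; rewrite E p2 => <-; rewrite addr0.
  have E : Num.floor (y * 2) = 2 * k + 1.
    apply/eqP; rewrite floor_eq y2 /=; move: yk1; rewrite !intrD !intrM; lra.
  by move: yb; rewrite E intrD p2 add0r => <-.
split; last by rewrite yk intrD p2 add0r.
have : (b : nat)%:Z <= 1 by have := F2_le1 b; lia.
rewrite -(ler_int R) => b1.
have b0 : 0 <= (b : nat)%:Z%:~R :> R by rewrite ler0z.
apply/eqP; rewrite floor_eq.
have : (2 * k + (b : nat)%:Z)%:~R <= y * 2 < (2 * k + (b : nat)%:Z + 1)%:~R.
  by rewrite -floor_eq yk.
move: b0 b1; rewrite !intrD !intrM; move: (_%:~R) => c; lra.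
Qed.

Lemma dyadic_cyl (x : R) w : 0 <= x < 1 ->
  cyl w (dyadic x) <-> Num.floor (x * 2 ^+ size w) = wnum w.
Proof.
move=> x01; elim/last_ind: w => [|w b IH].
  rewrite expr0 mulr1 /wnum /=; split => // _.
  by apply/eqP; rewrite floor_eq add0r.
rewrite size_rcons exprSr mulrA /wnum foldl_rcons -/(wnum w).
rewrite -floor_double -IH; split => [H|[wx wb] j].
  split => [j jw|]; first by rewrite (H j) ?nth_rcons ?jw// size_rcons ltnW.
  have := H (size w); rewrite size_rcons ltnSn nth_rcons ltnn eqxx => <-//.
  by rewrite /= exprSr mulrA.
rewrite size_rcons ltnS leq_eqVlt nth_rcons => /orP[/eqP ->|jw].
  by rewrite ltnn eqxx /= exprSr mulrA.
by rewrite jw; exact: wx.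
Qed.

Lemma m01 : measurable (`[0, 1[%classic : set R).
Proof. exact: measurable_itv. Qed.

Lemma dyadic_cyl_itv w : dyadic @^-1` cyl w `&` `[0, 1[%classic =
  `[(wnum w)%:~R / 2 ^+ size w, (wnum w + 1)%:~R / 2 ^+ size w[%classic :> set R.
Proof.
have p2 : 0 < 2 ^+ size w :> R by rewrite exprn_gt0.
have E (x : R) : Num.floor (x * 2 ^+ size w) = wnum w <->
    (wnum w)%:~R / 2 ^+ size w <= x < (wnum w + 1)%:~R / 2 ^+ size w.
  rewrite ler_pdivrMr// ltr_pdivlMr// -floor_eq; split=> [->//|/eqP//].
apply/seteqP; split => [x [wx]|x]; rewrite /= !in_itv/=.
  by move=> x01; apply/E; apply/dyadic_cyl.
move=> wx; suff x01 : 0 <= x < 1 by split => //; apply/dyadic_cyl/E.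
case/andP: wx => wx xw; apply/andP; split.
  by apply: le_trans wx; rewrite divr_ge0 ?ler0z ?wnum_ge0// ltW.
apply: lt_le_trans xw _; rewrite ler_pdivrMr// mul1r.
have := wnum_lt w; rewrite -(ler_int R) => /le_trans; apply.
by rewrite -pmulrn natrX.
Qed.

Lemma measurable_dyadic :
  measurable_fun (`[0, 1[%classic : set R) dyadic.
Proof.
apply: (measurability _ measurable_cyls) => _ [B [->|[w ->]] <-].
  by rewrite preimage_set0 setI0.
by rewrite setIC dyadic_cyl_itv; exact: measurable_itv.
Qed.


Definition haar_fun (A : set unit_interval) : \bar R :=
  lebesgue_measure (dyadic @^-1` A `&` `[0, 1[%classic).

Let haar0 : haar_fun set0 = 0%E.
Proof. by rewrite /haar_fun preimage_set0 set0I measure0. Qed.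

Let haar_ge0 A : (0 <= haar_fun A)%E.
Proof. exact: measure_ge0. Qed.

Let haar_sigma_additive : semi_sigma_additive haar_fun.
Proof.
have mF A : measurable A ->
    measurable (dyadic @^-1` A `&` `[0, 1[%classic : set R).
  by move=> mA; rewrite setIC; apply: measurable_dyadic => //; exact: m01.
move=> F mFn tF mUF; rewrite /haar_fun preimage_bigcup setI_bigcupl.
apply: measure_semi_sigma_additive => //.
- by move=> n; exact: mF.
- apply/trivIsetP => /= i j _ _ ij; rewrite setIACA -preimage_setI.
  by move/trivIsetP : tF => /(_ i j I I ij) ->; rewrite preimage_set0 set0I.
- by rewrite -setI_bigcupl -preimage_bigcup; exact: mF.
Qed.

HB.instance Definition _ := isMeasure.Build _ _ _ haar_fun
  haar0 haar_ge0 haar_sigma_additive.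

Let haar_setT : haar_fun setT = 1%E.
Proof.
by rewrite /haar_fun preimage_setT setTI lebesgue_measure_itv/= lte_fin ltr01 sube0.
Qed.

HB.instance Definition _ := Measure_isProbability.Build _ _ _ haar_fun haar_setT.

Lemma haar_cyl w : haar_fun (cyl w) = (2 ^- size w)%:E.
Proof.
have p2 : 0 < 2 ^+ size w :> R by rewrite exprn_gt0.
rewrite /haar_fun dyadic_cyl_itv lebesgue_measure_itv/= lte_fin.
rewrite ltr_pM2r ?invr_gt0// ltr_int ifT; last by lia.
by rewrite -EFinD -mulrBl -intrB addrAC subrr add0r mul1r.
Qed.

Lemma haar_exists : exists mu : probability unit_interval R, is_haar mu.
Proof.
exists haar_fun => x A mA.
pose tr (y : unit_interval) := y - x.
have imE B : [set x + y | y in B] = tr @^-1` B.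
  apply/seteqP; split => [_ [y By <-]|y By]; first by rewrite /tr /= addrAC subrr add0r.
  by exists (tr y) => //; rewrite /tr addrC subrK.
have cylE w : tr @^-1` cyl w =
    cyl (mkseq (fun j => w`_j + x (Negz j)) (size w)).
  apply/seteqP; split => y wy j.
    rewrite size_mkseq => jw; rewrite nth_mkseq// -(wy j jw) /=.
    by rewrite !fctE /= subrK.
  move=> jw; have := wy j; rewrite size_mkseq nth_mkseq// => /(_ jw) yE.
  by rewrite /tr /= !fctE /= yE addrK.
have mtr : measurable_fun setT tr.
  apply: (measurability _ measurable_cyls) => _ [B [->|[w ->]] <-].
    by rewrite preimage_set0 setI0.
  by rewrite setTI cylE measurable_cyls; apply: sub_sigma_algebra; right; eexists.
pose TR : {mfun unit_interval >-> unit_interval} :=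
  HB.pack_for {mfun unit_interval >-> unit_interval} tr
    (isMeasurableFun.Build _ _ _ _ tr mtr).
rewrite imE -[LHS]/(pushforward haar_fun TR A).
apply: (@g_sigma_algebra_measure_unique _ R unit_interval cyls _ (fun=> setT)
  _ _ (pushforward haar_fun TR) haar_fun cyls_setI).
- by rewrite measurable_cyls; exact: sub_sigma_algebra.
- by move=> _; right; exists [::]; apply/seteqP; split.
- by rewrite bigcup_const//; exists 0%N.
- move=> _ [->|[w ->]]; first by rewrite !measure0.
  by rewrite -[LHS]/(haar_fun (tr @^-1` cyl w)) cylE /= !haar_cyl size_mkseq.
- by move=> _; rewrite -[X in (X < _)%E]/(haar_fun setT) haar_setT ltry.
- by rewrite -measurable_cyls.
Qed.

End haar_existence.

(* Main.v *)
Require Import Defs.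
From mathcomp Require Import all_boot all_order all_algebra.
From mathcomp Require Import qpoly mxabelem zify.
From mathcomp Require Import all_classical all_reals all_analysis.
From mathcomp Require Import measurable_realfun.
Set Implicit Arguments.
Unset Strict Implicit.
Unset Printing Implicit Defensive.
Import Order.TTheory GRing.Theory Num.Theory.
Local Open Scope classical_set_scope.
Local Open Scope ring_scope.

(* For fixed Y, orthogonality of characters makes the sums over Z and U vanish
   unless Y lies in the kernel of the two Hankel (persymmetric) matrices built
   on the digits of t and eta; hence g(t, eta) = 2^(2s+m) 2^(k-r), where r is the
   rank of the stacked matrix. So g depends only on the first s+k-1 digits of t
   and s+m+k-1 digits of eta, and its integral is the average over these
   digits, since a Haar measure gives mass 2^-n to each cylinder of length n.
   As the digits parametrize the pairs of persymmetric matrices, grouping them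
   by rank gives the right-hand side; expanding g^q and averaging the characters
   over the digits instead counts the solutions. *)

(** * Signs on the field with two elements and orthogonality *)

Definition sgn2 (R : pzRingType) (x : 'F_2) : R := (-1) ^+ x.

Lemma F2P (P : 'F_2 -> Prop) : P 0 -> P 1 -> forall x, P x.
Proof.
move=> P0 P1 [[|[|//]] i]; [move: P0|move: P1]; congr P; exact: val_inj.
Qed.

Lemma sgn2D (R : pzRingType) : {morph sgn2 R : x y / x + y >-> x * y}.
Proof.
move=> x y; elim/F2P: x; elim/F2P: y;
  by rewrite /sgn2 /= ?expr0 ?expr1 ?mulr1 ?mul1r ?mulrNN ?mulr1.
Qed.

Lemma F2_neq0 (x : 'F_2) : x != 0 -> x = 1.
Proof. by elim/F2P: x. Qed.

Lemma card_npoly2 n : #|{poly_n 'F_2}| = (2 ^ n)%N.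
Proof. by rewrite card_npoly card_Fp. Qed.

(* If some c_i is nonzero then Z |-> Z + X^i flips the sign of each term. *)
Lemma sum_sgn2_npoly (R : numDomainType) n (c : 'I_n -> 'F_2) :
  \sum_(Z : {poly_n 'F_2}) sgn2 R (\sum_(i < n) c i * Z`_i) =
  if [forall i, c i == 0] then 2 ^+ n else 0.
Proof.
case: ifPn => [/forallP c0|].
  under eq_bigr do [rewrite big1 => [|i _]; last by rewrite (eqP (c0 i)) mul0r].
  by rewrite sumr_const card_npoly2 /sgn2 expr0 natrX.
rewrite negb_forall => /existsP[i /F2_neq0 ci].
set S := LHS; suff : S = - S.
  by move/eqP; rewrite -subr_eq0 opprK -mulr2n mulrn_eq0 => /eqP.
rewrite {1}/S (reindex_inj (addIr (npolyp n 'X^i))) /= -sumrN.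
apply: eq_bigr => Z _.
under eq_bigr do rewrite coefD mulrDr.
rewrite big_split /= sgn2D -mulrN1; congr (_ * _).
rewrite (bigD1 i) //= big1 ?addr0 => [|j ji]; rewrite coef_npolyp coefXn ltn_ord.
  by rewrite eqxx ci mulr1 /sgn2 expr1.
by rewrite -val_eqE in ji; rewrite (negPf ji) mulr0.
Qed.

(** * Products of Laurent series with polynomials *)

Lemma lconv_poly (a : int -> 'F_2) (p : {poly 'F_2}) N n : (size p <= N)%N ->
  lconv a (poly_coefz p) n = \sum_(j < N) a (n - j%:Z) * p`_j.
Proof.
move=> pN; rewrite /lconv; pose F (i : int) := a i * poly_coefz p (n - i).
pose h (j : nat) : int := n - j%:Z.
transitivity (\sum_(j < N) F (h j)); last first.
  by apply: eq_bigr => j _; rewrite /F /h subKr.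
rewrite (fsbig_ord _ _ (fun j => F (h j))) -(@fsbig_image _ _ _ _ _ _ h F).
  symmetry; apply: fsbig_widen => // i [_ hi]; change (F i = 0); rewrite /F.
  (* For [i] outside the image of [h], [n - i] is negative or at least [N], and [poly_coefz p]
     vanishes there. *)
  case E : (n - i) => [j|j]; last by rewrite mulr0.
  rewrite /= nth_default ?mulr0//; rewrite leqNgt; apply/negP => jp; apply: hi.
  by exists j => /=; [exact: leq_trans jp pN | rewrite /h -E subKr].
by move=> i j _ _; rewrite /h; lia.
Qed.

Lemma coef_laurent_mul (t : laurent) (p : {poly 'F_2}) N n : (size p <= N)%N ->
  (t * laurent_of_poly p) n = \sum_(j < N) t (n - j%:Z) * p`_j.
Proof. exact: lconv_poly. Qed.

Lemma laurent_of_polyM : {morph laurent_of_poly : p q / p * q}.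
Proof.
move=> p q; apply: laurentP => n.
rewrite (coef_laurent_mul _ _ (leqnn _)); case: n => [n|n] /=; last first.
  by rewrite big1 // => j _; rewrite (_ : Negz n - _ = Negz (n + j)) ?mul0r//; lia.
rewrite coefMr.
(* Both sums are extended to a common range. The guard matters: for [j > n] the truncated [n - j]
   would pick up the constant term of [p]. *)
pose F j := (if (j <= n)%N then p`_(n - j) else 0) * q`_j.
transitivity (\sum_(j < (maxn n.+1 (size q))) F j).
  rewrite -(big_mkord xpredT F) (big_cat_nat (n := n.+1)) ?leq_maxl//=.
  rewrite [X in _ + X]big_nat_cond [X in _ + X]big1 ?addr0; last first.
    by move=> j; rewrite andbT => /andP[nj _]; rewrite /F leqNgt nj mul0r.
  by rewrite big_mkord; apply: eq_bigr => j _; rewrite /F -ltnS ltn_ord.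
rewrite -(big_mkord xpredT F) (big_cat_nat (n := size q)) ?leq_maxr//=.
rewrite [X in _ + X]big_nat_cond [X in _ + X]big1 ?addr0; last first.
  by move=> j; rewrite andbT => /andP[nj _]; rewrite /F [X in _ * X]nth_default ?mulr0.
rewrite big_mkord; apply: eq_bigr => j _; rewrite /F; congr (_ * _).
case: leqP => jn; first by rewrite subzn.
by rewrite (_ : n%:Z - _ = Negz (j - n).-1)//; lia.
Qed.

Lemma laurent_of_polyD : {morph laurent_of_poly : p q / p + q}.
Proof.
by move=> p q; apply: laurentP => -[n|n]; rewrite /= !fctE /= ?coefD ?addr0.
Qed.

(** The character reads the coefficient of T^-1, and -1 - j is [Negz j]. *)
Lemma lchar_mul_poly (R : realType) (t : laurent) (p : {poly 'F_2}) N : (size p <= N)%N ->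
  lchar R (t * laurent_of_poly p) = sgn2 R (\sum_(j < N) t (Negz j) * p`_j).
Proof.
move=> pN; rewrite /lchar (coef_laurent_mul _ _ pN).
by congr (sgn2 R _); apply: eq_bigr => j _; congr (t _ * _); lia.
Qed.

Lemma lcharD (R : realType) (t u : laurent) : lchar R (t + u) = lchar R t * lchar R u.
Proof. exact: (sgn2D R). Qed.

Lemma lchar_sum (R : realType) (I : Type) (r : seq I) (t : laurent)
    (F : I -> {poly 'F_2}) :
  lchar R (t * laurent_of_poly (\sum_(i <- r) F i)) =
  \prod_(i <- r) lchar R (t * laurent_of_poly (F i)).
Proof.
apply: (big_morph (fun p => lchar R (t * laurent_of_poly p))) => [p q|].
  by rewrite laurent_of_polyD mulrDr lcharD.
by rewrite (@lchar_mul_poly R t 0 0) ?size_poly0// big_ord0 /sgn2 expr0.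
Qed.

(** * Hankel matrices and the value of g *)

(** Matrix, in the monomial bases, of the bilinear form sending (Z, Y) to the coefficient of T^-1 in
    tYZ. *)
Definition hankel (s k : nat) (t : laurent) : 'M['F_2]_(s, k) :=
  \matrix_(i < s, j < k) t (Negz (i + j)).

(** Here [c i] is the coefficient of T^-(i+1) in tY; orthogonality asks that all of them vanish. *)
Lemma sum_lchar_hankel (R : realType) s k (t : laurent) (Y : {poly_k 'F_2}) :
  \sum_(Z : {poly_s 'F_2})
    lchar R (t * laurent_of_poly Y * laurent_of_poly Z) =
  if npoly_rV Y *m (hankel s k t)^T == 0 then 2 ^+ s else 0.
Proof.
pose c (i : 'I_s) := (npoly_rV Y *m (hankel s k t)^T) 0 i.
transitivity (\sum_(Z : {poly_s 'F_2}) sgn2 R (\sum_(i < s) c i * Z`_i)).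
  apply: eq_bigr => Z _; rewrite (lchar_mul_poly R _ (size_npoly Z)).
  congr (sgn2 R _); apply: eq_bigr => i _; congr (_ * _).
  rewrite (coef_laurent_mul _ _ (size_npoly Y)) /c mxE.
  apply: eq_bigr => j _; rewrite !mxE mulrC; congr (_ * t _); lia.
rewrite sum_sgn2_npoly; congr (if _ then _ else _); apply/forallP/eqP => [c0|c0 i].
  by apply/rowP => i; rewrite [RHS]mxE; exact/eqP/c0.
by rewrite /c c0 mxE.
Qed.

(** Rank-nullity, with polynomials transported to row vectors by [npoly_rV]. *)
Lemma card_ker_npoly (n k : nat) (M : 'M['F_2]_(n, k)) :
  #|[set Y : {poly_k 'F_2} | npoly_rV Y *m M^T == 0]%SET| = (2 ^ (k - \rank M))%N.
Proof.
rewrite -mxrank_tr -mxrank_ker -[X in (X ^ _)%N](@card_Fp 2)// -card_rowg.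
rewrite -(card_imset _ (can_inj (@npoly_rV_K _ _))); apply: eq_card => v.
rewrite inE; apply/imsetP/idP => [[Y + ->]|]; rewrite ?inE sub_kermx//.
by move=> vM; exists (rVnpoly v); rewrite ?inE rVnpolyK.
Qed.

(** Only the [Y] killed by both matrices, hence by the stacked one, contribute, each with the full
    sums over [Z] and [U]. *)
Lemma g_sum_rank (R : realType) k s m (t u : laurent) :
  g_sum R k s m t u =
  2 ^+ (s + (s + m)) * 2 ^+ (k - \rank (col_mx (hankel s k t) (hankel (s + m) k u))).
Proof.
rewrite -[X in _ * X]natrX -card_ker_npoly -sum1_card natr_sum mulr_sumr.
rewrite big_mkcond /g_sum; apply: eq_bigr => Y _.
rewrite -big_distrl !sum_lchar_hankel inE tr_col_mx mul_mx_row row_mx_eq0 /=.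
by case: eqP => _ /=; rewrite ?mul0r//; case: eqP => _ /=; rewrite ?mulr0 ?mulr1 ?exprD.
Qed.

(** * Digits, cylinders and integration *)

Definition digits_coef (p : {poly 'F_2}) (i : int) : 'F_2 :=
  if i is Negz j then p`_j else 0.

Lemma upper_bounded_digits p : upper_bounded (digits_coef p).
Proof. by apply/asboolP; exists 0; case. Qed.

Lemma in_unit_interval_digits p : in_unit_interval (Laurent (upper_bounded_digits p)).
Proof. by apply/asboolP; case. Qed.

(* The element of the unit interval whose j-th digit (coefficient of T^-(j+1))
   is the coefficient of X^j in p. *)
Definition of_digits (p : {poly 'F_2}) : unit_interval :=
  UnitInterval (in_unit_interval_digits p).

Definition dig (n : nat) (x : unit_interval) : {poly_n 'F_2} :=
  mk_npoly n (fun j => x (Negz j)).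

Lemma coef_dig n x j : (j < n)%N -> (dig n x)`_j = x (Negz j).
Proof. by move=> jn; rewrite /= coef_poly jn. Qed.

Lemma digP n x y :
  dig n x = dig n y <-> (forall j, (j < n)%N -> x (Negz j) = y (Negz j)).
Proof.
split=> [xy j jn|xy]; first by rewrite -(coef_dig _ jn) xy coef_dig.
by apply/val_inj/polyP => j /=; rewrite !coef_poly; case: ifP => // /xy.
Qed.

Lemma of_digitsK n (a : {poly_n 'F_2}) : dig n (of_digits a) = a.
Proof.
apply/val_inj/polyP => j /=; rewrite coef_poly; case: ltnP => // nj.
by rewrite big_coef_npoly.
Qed.

(** The same sets as [cyl], indexed by a finite type so that one can sum over all cylinders of a
    given length. *)
Definition dcyl n (a : {poly_n 'F_2}) : set unit_interval := dig n @^-1` [set a].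

Lemma dcylP n (a : {poly_n 'F_2}) (x : unit_interval) :
  dcyl a x <-> (forall j, (j < n)%N -> x (Negz j) = a`_j).
Proof.
split=> [xa j jn|xa]; first by rewrite -(coef_dig _ jn) xa.
by apply: (etrans _ (of_digitsK a)); apply/digP.
Qed.

Lemma measurable_dcyl n (a : {poly_n 'F_2}) : measurable (dcyl a).
Proof.
suff -> : dcyl a = cyl (mkseq (fun j => a`_j) n).
  by apply: sub_sigma_algebra; exact: open_cyl.
apply/seteqP; split=> [x /dcylP xa j|x xa].
  by rewrite size_mkseq => jn; rewrite nth_mkseq// xa.
by apply/dcylP => j jn; rewrite xa ?size_mkseq// nth_mkseq.
Qed.

Lemma dcyl_translate n (a : {poly_n 'F_2}) :
  dcyl a = [set of_digits a + y | y in dcyl (0 : {poly_n 'F_2})].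
Proof.
apply/seteqP; split=> [x /dcylP xa|_ [y /dcylP y0 <-]]; last first.
  by apply/dcylP => j jn; rewrite /= !fctE /= y0// coef0 addr0.
exists (x - of_digits a); last by rewrite addrC subrK.
by apply/dcylP => j jn; rewrite /= !fctE /= xa// coef0 subrr.
Qed.

(** The 2^n cylinders of length n partition the unit interval and are translates of one another, so
    they share its mass equally. *)
Lemma haar_dcyl (R : realType) (mu : probability unit_interval R) n
    (a : {poly_n 'F_2}) : is_haar mu -> mu (dcyl a) = (2 ^- n)%:E.
Proof.
move=> haar; rewrite dcyl_translate haar; last exact: measurable_dcyl.
set c := mu _; have cfin : c \is a fin_num by exact: fin_num_measure (measurable_dcyl _).
have : \sum_(a : {poly_n 'F_2}) mu (dcyl a) = 1%E.
  rewrite -[RHS](@probability_setT _ _ _ mu) (@fsbig_seq _ _ _ _ _ _ (index_enum_uniq _)).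
  rewrite -measure_fin_bigcup //=.
  - congr (mu _); apply/seteqP; split=> // x _.
    by exists (dig n x) => //=; exact: mem_index_enum.
  - by move=> b b' _ _ [x [<- <-]].
  - by move=> b _; exact: measurable_dcyl.
under eq_bigr do rewrite dcyl_translate (haar _ _ (measurable_dcyl _)) -/c -(fineK cfin).
rewrite sumEFin sumr_const card_npoly2 => -[] c1; rewrite -(fineK cfin); congr EFin.
apply: (@mulIf _ (2 ^+ n)); first by rewrite expf_neq0// pnatr_eq0.
by rewrite mulVf ?expf_neq0 ?pnatr_eq0// -natrX mulr_natr.
Qed.

(** Depending on finitely many digits, [f] is a finite combination of indicators of products of
    cylinders, each of mass 2^-(n+p). *)
Lemma integral_dig (R : realType) (mu : probability unit_interval R) n p
    (f : unit_interval -> unit_interval -> R) : is_haar mu ->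
  (forall x y, 0 <= f x y) ->
  (forall x y, f x y = f (of_digits (dig n x)) (of_digits (dig p y))) ->
  (\int[(mu \x mu)%E]_x (f x.1 x.2)%:E =
   (2 ^- (n + p) * \sum_(a : {poly_n 'F_2}) \sum_(b : {poly_p 'F_2})
     f (of_digits a) (of_digits b))%:E)%E.
Proof.
move=> haar f0 fE.
pose F (ab : {poly_n 'F_2} * {poly_p 'F_2})
    (x : unit_interval * unit_interval) : \bar R :=
  ((f (of_digits ab.1) (of_digits ab.2))%:E * (\1_(dcyl ab.1 `*` dcyl ab.2) x)%:E)%E.
have mR ab : measurable (dcyl ab.1 `*` dcyl ab.2 : set (unit_interval * unit_interval)).
  by apply: measurableX; exact: measurable_dcyl.
transitivity (\int[(mu \x mu)%E]_x (\sum_(ab : {poly_n 'F_2} * {poly_p 'F_2}) F ab x))%E.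
  (* Only the term indexed by the leading digits of [x] and [y] survives. *)
  apply: eq_integral => -[x y] _; rewrite (bigD1 (dig n x, dig p y)) //= big1 ?adde0.
    by rewrite /F indicE mem_set ?mule1 -?fE.
  move=> [a b] ab; rewrite /F indicE memNset ?mule0// => -[/= xa yb].
  by move: ab; rewrite -xa -yb eqxx.
rewrite ge0_integral_sum //=; last 2 first.
- by move=> ab; apply: measurable_funeM; apply/measurable_EFinP; exact: measurable_indic.
- by move=> ab x _; rewrite mule_ge0 ?lee_fin// indicE.
rewrite pair_bigA mulr_sumr -sumEFin; apply: eq_bigr => ab _.
rewrite ge0_integralZl_EFin//; last first.
- by apply/measurable_EFinP; exact: measurable_indic.
rewrite integral_indic// setIT /=.
rewrite [X in (_ * X)%E]product_measure1E; try exact: measurable_dcyl.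
transitivity ((f (of_digits ab.1) (of_digits ab.2))%:E * ((2 ^- n)%:E * (2 ^- p)%:E))%E.
  by congr (_ * (_ * _))%E; exact: haar_dcyl.
by rewrite -!EFinM exprD invfM mulrC.
Qed.

(** * Counting the solutions *)

(** Orthogonality with the roles exchanged: the digits vary and the coefficients of [P] form the
    linear functional. The size bound lets [n] coefficients decide whether [P] is zero. *)
Lemma sum_lchar_of_digits (R : realType) n (P : {poly 'F_2}) : (size P <= n)%N ->
  \sum_(a : {poly_n 'F_2}) lchar R (unit_val (of_digits a) * laurent_of_poly P) =
  if P == 0 then 2 ^+ n else 0.
Proof.
move=> Pn; under eq_bigr => a _.
  rewrite (lchar_mul_poly R _ Pn); under eq_bigr do rewrite mulrC; over.
rewrite (sum_sgn2_npoly R (fun i : 'I_n => P`_i)).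
congr (if _ then _ else _); apply/forallP/eqP => [P0|-> i]; last by rewrite coef0.
apply/polyP => i; rewrite coef0; have [ni|ni] := ltnP i n.
  exact/eqP/(P0 (Ordinal ni)).
by rewrite nth_default// (leq_trans Pn).
Qed.

(** The bound is the number of antidiagonals of a Hankel matrix, so the digits that determine g
    suffice to test whether such a sum vanishes. *)
Lemma size_sum_mul_npoly q n p (y : 'I_q -> {poly_n 'F_2}) (z : 'I_q -> {poly_p 'F_2}) :
  (size (\sum_(j < q) polyn (y j) * polyn (z j))%R <= (p + n).-1)%N.
Proof.
apply: leq_trans (size_sum _ _ _) _; apply/bigmax_leqP => j _.
apply: leq_trans (size_polyMleq _ _) _.
by have := leq_add (size_npoly (y j)) (size_npoly (z j)); lia.
Qed.

(** Each factor of the power gets its own triple, and multiplicativity of the character gathers the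
    factors into the left-hand sides of the two equations. *)
Lemma g_sum_exp (R : realType) q k s m (t u : laurent) :
  g_sum R k s m t u ^+ q =
  \sum_(w : {ffun 'I_q -> {poly_k 'F_2} * {poly_s 'F_2} * {poly_(s + m) 'F_2}})
    lchar R (t * laurent_of_poly (\sum_(j < q) polyn (w j).1.1 * polyn (w j).1.2)) *
    lchar R (u * laurent_of_poly (\sum_(j < q) polyn (w j).1.1 * polyn (w j).2)).
Proof.
have -> : g_sum R k s m t u =
    \sum_(v : {poly_k 'F_2} * {poly_s 'F_2} * {poly_(s + m) 'F_2})
      lchar R (t * laurent_of_poly (polyn v.1.1 * polyn v.1.2)) *
      lchar R (u * laurent_of_poly (polyn v.1.1 * polyn v.2)).
  rewrite /g_sum pair_bigA /=; under eq_bigr do rewrite mulr_sumr.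
  rewrite pair_bigA /=; apply: eq_bigr => v _.
  by rewrite !laurent_of_polyM !mulrA.
set S := \sum_v _; have -> : S ^+ q = \prod_(j < q) S by rewrite prodr_const card_ord.
rewrite bigA_distr_bigA; apply: eq_bigr => w _.
by rewrite big_split; congr (_ * _); rewrite [RHS]lchar_sum.
Qed.

(** Once the sums are exchanged, a tuple contributes the number of digit pairs if it solves both
    equations, and 0 otherwise. *)
Lemma sum_g_sum_exp (R : realType) q k s m :
  \sum_(a : {poly_(s + k).-1 'F_2}) \sum_(b : {poly_(s + m + k).-1 'F_2})
    g_sum R k s m (of_digits a) (of_digits b) ^+ q =
  2 ^+ ((s + k).-1 + (s + m + k).-1) * (num_sol q k s m)%:R.
Proof.
under eq_bigr do under eq_bigr do rewrite g_sum_exp.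
under eq_bigr do rewrite exchange_big /=.
rewrite exchange_big /= /num_sol -sum1_card natr_sum mulr_sumr [RHS]big_mkcond.
apply: eq_bigr => w _; under eq_bigr do rewrite -mulr_sumr.
rewrite -mulr_suml !sum_lchar_of_digits ?size_sum_mul_npoly// inE.
by case: eqP => _ /=; rewrite ?mul0r//; case: eqP => _ /=; rewrite ?mulr0 ?mulr1 ?exprD.
Qed.

(** * Persymmetric matrices and their ranks *)

Lemma persymmetricP s k (A : 'M['F_2]_(s, k)) :
  reflect (forall (i1 : 'I_s) (j1 : 'I_k) (i2 : 'I_s) (j2 : 'I_k),
             (i1 + j1 = i2 + j2)%N -> A i1 j1 = A i2 j2)
          (persymmetric A).
Proof.
apply: (iffP idP) => [+ i1 j1 i2 j2 /eqP e|H].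
  move=> /forallP/(_ i1)/forallP/(_ j1)/forallP/(_ i2)/forallP/(_ j2).
  by rewrite e => /eqP.
do 4 (apply/forallP => ?); apply/implyP => /eqP e; exact/eqP/H.
Qed.

(** A persymmetric matrix amounts to a free choice of one value on each of its s+k-1 antidiagonals.
    Positivity provides the first column and last row where they are read. *)
Lemma sum_hankel (V : nmodType) s k (F : 'M['F_2]_(s, k) -> V) :
  (0 < s)%N -> (0 < k)%N ->
  \sum_(a : {poly_(s + k).-1 'F_2}) F (hankel s k (of_digits a)) =
  \sum_(A | persymmetric A) F A.
Proof.
case: s k F => // s [//|k] F _ _.
pose h (a : {poly_(s.+1 + k.+1).-1 'F_2}) := hankel s.+1 k.+1 (of_digits a).
have hP a : persymmetric (h a).
  by apply/persymmetricP => i1 j1 i2 j2 e; rewrite !mxE e.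
(* Antidiagonal l is read along the first column, then along the last row. *)
pose g (A : 'M['F_2]_(s.+1, k.+1)) : {poly_(s.+1 + k.+1).-1 'F_2} :=
  mk_npoly _ (fun l => A (inord (minn l s)) (inord (l - s))).
rewrite (reindex h); last first.
  exists g => [a _|A]; last rewrite inE.
    apply/val_inj/polyP => l /=; rewrite coef_poly; case: ltnP => lsk; last first.
      by rewrite big_coef_npoly.
    by rewrite mxE /= !inordK; [congr (_`_ _)|..]; lia.
  move=> /persymmetricP AP; apply/matrixP => i j; rewrite mxE /= coef_poly.
  have [si kj] := (ltn_ord i, ltn_ord j).
  by rewrite ifT; [apply: AP; rewrite !inordK|]; lia.
by apply: eq_bigl => a; rewrite hP.
Qed.

Lemma sum_col_mx_persymmetric (V : nmodType) s m k (F : 'M['F_2]_(s + m, k) -> V) :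
  \sum_(A | persymmetric A) \sum_(B | persymmetric B) F (col_mx A B) =
  \sum_(M | persymmetric (usubmx M) && persymmetric (dsubmx M)) F M.
Proof.
rewrite pair_big /= (reindex (fun M : 'M['F_2]_(s + m, k) => (usubmx M, dsubmx M))) /=.
  by apply: eq_bigr => M _; rewrite vsubmxK.
exists (fun AB => col_mx AB.1 AB.2) => [M _|[A B] _]; first by rewrite vsubmxK.
by rewrite /= col_mxKu col_mxKd.
Qed.

Lemma sum_num_rank (R : pzRingType) s m k (f : nat -> R) :
  \sum_(M : 'M['F_2]_(s + (s + m), k)
    | persymmetric (usubmx M) && persymmetric (dsubmx M))
     f (\rank M) =
  \sum_(0 <= i < (minn (2 * s + m) k).+1) (num_rank s m k i)%:R * f i.
Proof.
rewrite big_mkord.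
have rM (M : 'M['F_2]_(s + (s + m), k)) : (\rank M < (minn (2 * s + m) k).+1)%N.
  by have := rank_leq_row M; have := rank_leq_col M; lia.
rewrite (partition_big (fun M => Ordinal (rM M)) xpredT) //=.
apply: eq_bigr => i _; rewrite /num_rank -sum1_card natr_sum mulr_suml.
apply: eq_big => [M|M /andP[_ /eqP <-]]; last by rewrite mul1r.
by rewrite inE -andbA -val_eqE.
Qed.

(** The largest index [i + j] is s+k-2, the last digit kept. *)
Lemma hankel_dig s k (x : unit_interval) :
  hankel s k (of_digits (dig (s + k).-1 x)) = hankel s k x.
Proof.
apply/matrixP => i j; rewrite !mxE.
have [si kj] := (ltn_ord i, ltn_ord j).
have ijn : (i + j < (s + k).-1)%N by lia.
by rewrite -[RHS](coef_dig x ijn).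
Qed.

Theorem theorem2p15 (R : realType) (mu : probability unit_interval R)
    (q k s m : nat) :
  is_haar mu -> (0 < q)%N -> (0 < k)%N -> (0 < s)%N ->
  ((num_sol q k s m)%:R%:E =
     \int[(mu \x mu)%E]_x (g_sum R k s m x.1 x.2 ^+ q)%:E)%E /\
  (\int[(mu \x mu)%E]_x (g_sum R k s m x.1 x.2 ^+ q)%:E =
     (2 ^+ ((2 * s + m + k) * (q - 1)) * 2 ^ (- k%:Z + 2) *
      \sum_(0 <= i < (minn (2 * s + m) k).+1)
        (num_rank s m k i)%:R * 2 ^- (q * i))%:E)%E.
Proof.
move=> haar q0 k0 s0.
have two0 n : 2 ^+ n != 0 :> R by rewrite expf_neq0// pnatr_eq0.
rewrite (@integral_dig _ _ (s + k).-1 (s + m + k).-1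
  (fun x y => g_sum R k s m x y ^+ q)) //; last 2 first.
- by move=> x y; rewrite g_sum_rank exprn_ge0// mulr_ge0// exprn_ge0.
- by move=> x y; rewrite !g_sum_rank !hankel_dig.
split; congr EFin; first by rewrite sum_g_sum_exp mulKf.
(* The value of g^q when the stacked matrix has rank [r], since then g = 2^(2s+m+k-r). *)
pose f r : R := 2 ^+ ((2 * s + m + k) * q) * 2 ^- (q * r).
have gE (A : 'M['F_2]_(s, k)) (B : 'M['F_2]_(s + m, k)) :
    (2 ^+ (s + (s + m)) * 2 ^+ (k - \rank (col_mx A B))) ^+ q = f (\rank (col_mx A B)).
  (* Clearing 2^(qr) leaves natural exponents; the subtraction of the rank from [k] is exact because
     the rank is at most [k]. *)
  apply: (mulIf (two0 (q * \rank (col_mx A B))%N)); rewrite /f divfK//.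
  rewrite -exprD -exprM -exprD mulnC -mulnDr mulnC; congr (_ ^+ (_ * q)).
  by have := rank_leq_col (col_mx A B); lia.
under eq_bigr do under eq_bigr do rewrite g_sum_rank gE.
have sm0 : (0 < s + m)%N by rewrite addn_gt0 s0.
under eq_bigr => a _ do
  rewrite (sum_hankel (fun B => f (\rank (col_mx (hankel s k (of_digits a)) B))) sm0 k0).
rewrite (sum_hankel (fun A => \sum_(B | persymmetric B) f (\rank (col_mx A B))))//.
rewrite (sum_col_mx_persymmetric (fun M => f (\rank M))) sum_num_rank.
under eq_bigr do rewrite /f mulrCA.
rewrite -mulr_sumr mulrA; congr (_ * _).
have -> : 2 ^ (- k%:Z + 2) = 2 ^+ 2 * 2 ^- k :> R.
  by rewrite expfzDr ?pnatr_eq0// -exprnN mulrC.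
(* With 2^k and the number of digit pairs cleared, the exponents satisfy (2s+m+k)q + k = (2s+m+2k-2)
   + (2s+m+k)(q-1) + 2, which explains the factor 2^(-k+2). *)
apply: (mulIf (two0 k)); apply: (mulfI (two0 ((s + k).-1 + (s + m + k).-1)%N)).
rewrite -[in LHS]mulrA mulVKf// -[X in _ = _ * X]mulrA divfK// -!exprD; congr (_ ^+ _).
case: q q0 {f gE} => // q _; rewrite subn1 mulnSr; lia.
Qed.
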